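(* Let $n\ge1$, let $F$ be admissible on $[0,\infty)$, let $d>n/2$, and let $\phi\in\mathcal{L}$. Then $U_d[\phi]$ possesses the eventual $F$-concavity property if and only if $F$-concavity is weaker than log-concavity in $\mathcal{A}([0,\infty))$.
   Context: $\mathcal{L}$ is the set of nontrivial (not a.e. zero), nonnegative, bounded measurable functions on $\mathbb{R}^n$ with compact support. For $\phi\in\mathcal{L}$, $(e^{t\Delta}\phi)(x):=(4\pi t)^{-n/2}\int_{\mathbb{R}^n}e^{-|x-y|^2/(4t)}\phi(y)\,dy$ and $U_d[\phi](x,t):=(4\pi t)^d(e^{t\Delta}\phi)(x)$ for $(x,t)\in\mathbb{R}^n\times(0,\infty)$. Let $I=[0,\infty)$. A function $F:I\to[-\infty,\infty)$ is admissible on $I$ if $F$ is continuous on $(0,\infty)$, strictly increasing on $I$, and $F(0)=-\infty$. $\mathcal{A}(I)$ is the set of $I$-valued functions on $\mathbb{R}^n$. $f\in\mathcal{A}(I)$ is $F$-concave in $\mathbb{R}^n$ if $F(f((1-\mu)x+\mu y))\ge(1-\mu)F(f(x))+\mu F(f(y))$ for all $x,y\in\mathbb{R}^n$, $\mu\in(0,1)$; $\mathcal{C}[F]$ denotes the set of $F$-concave functions. For admissible $F_1,F_2$ on $I$, $F_1$-concavity is weaker than $F_2$-concavity in $\mathcal{A}(I)$ if $\mathcal{C}[F_2]\subset\mathcal{C}[F_1]$. Log-concavity is $F$-concavity for $F=\log$ (with $\log0=-\infty$). $U_d[\phi]$ possesses the eventual $F$-concavity property if there exists $T>0$ such that $U_d[\phi](\cdot,t)$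 is $F$-concave in $\mathbb{R}^n$ for all $t\in[T,\infty)$. *)

(* Defs.v *)
From HB Require Import structures.
From mathcomp Require Import all_boot all_order all_algebra.
From mathcomp Require Import all_classical all_reals all_analysis.

Set Implicit Arguments.
Unset Strict Implicit.
Unset Printing Implicit Defensive.

Import Order.TTheory GRing.Theory Num.Theory.
Import numFieldTopology.Exports numFieldNormedType.Exports.

Local Open Scope classical_set_scope.
Local Open Scope ring_scope.

(** The space R^n, n >= 1, is ['rV[R]_n.+1]. MathComp-Analysis has no
    n-dimensional Lebesgue measure, so it is built here as the Caratheodory
    restriction of the outer measure given by countable covers by boxes. *)

Section Lebesgue.
Context {R : realType} {n : nat}.
Local Notation E := 'rV[R]_n.+1.
Implicit Types (A : set E) (B : nat -> E * E).

Definition box (ab : E * E) : set E :=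
  [set x | forall i, ab.1 0 i < x 0 i <= ab.2 0 i].

Definition box_volume (ab : E * E) : R :=
  \prod_(i < n.+1) Num.max 0 (ab.2 0 i - ab.1 0 i).

Definition box_cover A : set (nat -> E * E) :=
  [set B | A `<=` \bigcup_k box (B k)].

Definition lebesgue_outer A : \bar R :=
  ereal_inf [set (\sum_(0 <= k <oo) (box_volume (B k))%:E)%E | B in box_cover A].

Lemma box_volume_ge0 ab : 0 <= box_volume ab.
Proof. by apply: prodr_ge0 => i _; rewrite le_max lexx. Qed.

Local Lemma le_lebesgue_outer :
  {homo lebesgue_outer : A B / A `<=` B >-> (A <= B)%E}.
Proof.
move=> A A' AA'; apply/ereal_inf_le_tmp => x [B A'B <-].
by exists B => //; apply: subset_trans AA' A'B.
Qed.

Local Lemma lebesgue_outer_ge0 A : (0 <= lebesgue_outer A)%E.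
Proof.
apply: le_ereal_inf_tmp => _ [B _ <-].
by apply: nneseries_ge0 => k _ _; rewrite lee_fin box_volume_ge0.
Qed.

Local Lemma lebesgue_outer0 : lebesgue_outer set0 = 0%E.
Proof.
apply/eqP; rewrite eq_le lebesgue_outer_ge0 andbT.
apply: ereal_inf_lbound; exists (fun=> (0, 0)); first exact: sub0set.
apply: eseries0 => k _ _.
by rewrite /box_volume big_ord_recl !mxE subrr maxxx mul0r.
Qed.

Local Lemma lebesgue_outer_sigma_subadditive : sigma_subadditive lebesgue_outer.
Proof.
move=> A; have [[i ioo]|] := pselect (exists i, lebesgue_outer (A i) = +oo%E).
  rewrite (eseries_pinfty _ _ ioo) ?leey// => k _.
  by rewrite -ltNye (lt_le_trans _ (lebesgue_outer_ge0 _)).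
rewrite -forallNE => Aoo.
suff add2e (e : {posnum R}) : (lebesgue_outer (\bigcup_n A n) <=
    \sum_(0 <= i <oo) lebesgue_outer (A i) + e%:num%:E)%E.
  by apply/lee_addgt0Pr => _/posnumP[].
rewrite (le_trans _ (epsilon_trick _ _ _))//; last first.
  by move=> k; exact: lebesgue_outer_ge0.
pose P k B := box_cover (A k) B /\ (\sum_(0 <= j <oo) (box_volume (B j))%:E <=
  lebesgue_outer (A k) + (e%:num / (2 ^ k.+1)%:R)%:E)%E.
have [G PG] : {G : nat -> nat -> E * E & forall k, P k (G k)}.
  apply: (@choice _ _ P) => k; rewrite /P /lebesgue_outer.
  set S := (X in ereal_inf X); move infS : (ereal_inf S) => iS.
  case: iS infS => [r Sr|Soo|Soo].
  - have en1 : 0 < e%:num / (2 ^ k.+1)%:R by [].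
    have /(lb_ereal_inf_adherent en1) : ereal_inf S \is a fin_num by rewrite Sr.
    move=> [x [B AB vBx] xS].
    by exists B; split => //; rewrite vBx -Sr; exact/ltW.
  - by have := Aoo k; rewrite /lebesgue_outer Soo.
  - by have := lebesgue_outer_ge0 (A k); rewrite /lebesgue_outer Soo.
pose v (kj : nat * nat) : \bar R := (box_volume (uncurry G kj))%:E.
have v_ge0 kj : (0 <= v kj)%E by rewrite lee_fin box_volume_ge0.
apply: (@le_trans _ _ (\esum_(i in setT) v i)%E).
  apply: ereal_inf_lbound => /=.
  have /card_esym/ppcard_eqP[f] := card_nat2.
  exists (uncurry G \o f).
    move=> t [i _] /((PG i).1)[j _ Gijt]; exists (f^-1%FUN (i, j)) => //=.
    by rewrite invK ?inE.
  rewrite -(esum_pred_image v _ xpredT) ?[fun=> _]set_true//.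
  by rewrite image_eq.
rewrite (_ : esum _ _ =
    (\sum_(0 <= i <oo) \sum_(0 <= j <oo) v (i, j))%E); last first.
  pose J : nat -> set (nat * nat) := fun i => [set (i, j) | j in setT].
  rewrite (_ : setT = \bigcup_k J k); last first.
    by rewrite predeqE => -[a b]; split => // _; exists a => //; exists b.
  rewrite esum_bigcupT //=; last first.
    apply/trivIsetP => i j _ _ ij.
    rewrite predeqE => -[k m] /=; split => //= -[] [_] _ [<-{k} _].
    by move=> [m' _] [] /esym/eqP; rewrite (negbTE ij).
  rewrite -(image_id [set: nat]) -fun_true esum_pred_image//; last first.
    by move=> k _; exact: esum_ge0.
  apply: eq_eseriesr => /= j _.
  rewrite -(esum_pred_image v (pair j) predT)//=; last first.
    by move=> ? ? _ _; exact: (@can_inj _ _ _ snd).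
  by congr esum; rewrite predeqE => -[a b]; split; move=> [i _ <-]; exists i.
apply: lee_lim.
- apply: is_cvg_nneseries => k *.
  by apply: nneseries_ge0 => m *; exact: v_ge0.
- apply: is_cvg_nneseries => k *; apply: adde_ge0 => //.
  exact: lebesgue_outer_ge0.
- by near=> k; apply: lee_sum => i _; exact: (PG i).2.
Unshelve. all: by end_near. Qed.

HB.instance Definition _ := isOuterMeasure.Build R E lebesgue_outer
  lebesgue_outer0 lebesgue_outer_ge0 le_lebesgue_outer
  lebesgue_outer_sigma_subadditive.

Definition lebesgue_outer_measure : {outer_measure set E -> \bar R} :=
  lebesgue_outer.

Definition lebesgue_rV :
    {measure set (caratheodory_type lebesgue_outer_measure) -> \bar R} :=
  lebesgue_outer_measure.

End Lebesgue.
Arguments lebesgue_outer_measure : clear implicits.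
Arguments lebesgue_rV : clear implicits.

(** R^n with the sigma-algebra of Lebesgue measurable sets. *)
Notation lebesgue_rV_type R n := (caratheodory_type (lebesgue_outer_measure R n)).

Section HeatFlow.
Context {R : realType} {n : nat}.
Local Notation E := 'rV[R]_n.+1.
Implicit Types (phi : E -> R) (x : E) (t d : R).

(** The class L. *)
Record heat_datum phi : Prop := HeatDatum {
  heat_datum_nontrivial : ~ {ae lebesgue_rV R n, forall y, phi y = 0};
  heat_datum_ge0 : forall y, 0 <= phi y;
  heat_datum_bounded : exists M, forall y, phi y <= M;
  heat_datum_measurable :
    measurable_fun [set: lebesgue_rV_type R n] (phi : lebesgue_rV_type R n -> R);
  heat_datum_support : compact (closure [set y | phi y != 0]) }.

(** Squared Euclidean norm; the library norm on ['rV[R]_n.+1] is the sup norm. *)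
Definition sqnorm x : R := \sum_(i < n.+1) x 0 i ^+ 2.

Definition heat phi t x : R :=
  (4 * pi * t) `^ (- (n.+1%:R / 2)) *
  \int[lebesgue_rV R n]_(y in [set: E]) (expR (- sqnorm (x - y) / (4 * t)) * phi y).

Definition U d phi x t : R := (4 * pi * t) `^ d * heat phi t x.

End HeatFlow.

Section FConcavity.
Context {R : realType}.
Implicit Types (F : R -> \bar R).

(** Functions on I = [0, +oo) are represented by functions on R whose values
    outside of I are irrelevant. *)
Definition admissible F : Prop :=
  [/\ forall r : R, 0 <= r -> (F r < +oo)%E,
      forall r : R, 0 < r -> {for r, continuous F},
      forall r s : R, 0 <= r -> r < s -> (F r < F s)%E
    & F 0 = -oo%E].

(** The set C[F]; the convex combination of extended reals is well-defined as
    F never takes the value +oo on I. *)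
Definition Fconcave (n : nat) F : set ('rV[R]_n.+1 -> R) :=
  [set f : 'rV[R]_n.+1 -> R | (forall x, 0 <= f x) /\
    forall (x y : 'rV[R]_n.+1) (mu : R), 0 < mu < 1 ->
      ((1 - mu)%:E * F (f x) + mu%:E * F (f y)
        <= F (f ((1 - mu) *: x + mu *: y)%R))%E].

Arguments Fconcave : clear implicits.

Definition weaker_concavity (n : nat) F1 F2 : Prop :=
  Fconcave n F2 `<=` Fconcave n F1.

Definition log (r : R) : \bar R := lne r%:E.

Lemma logE (r : R) : 0 < r -> log r = (ln r)%:E.
Proof. by move=> r0; rewrite /log lne_EFin. Qed.

Lemma log0 : log 0 = -oo%E.
Proof. by rewrite /log le0_lneNy. Qed.

Lemma admissible_log : admissible log.
Proof.
split=> [r|r r0|r s|]; last exact: log0.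
- by rewrite le_eqVlt => /predU1P[<-|r0]; rewrite ?log0// logE ?ltry.
- rewrite /prop_for /continuous_at logE//.
  apply: (@cvg_trans _ ((EFin \o @ln R) z @[z --> r])).
    apply: near_eq_cvg; near=> z; rewrite /= logE//.
    by near: z; exact: lt_nbhsr.
  apply: (cvg_comp (@ln R) EFin); [exact: continuous_ln | exact: cvg_id].
- rewrite le_eqVlt => /predU1P[<-|r0] rs; rewrite [log s]logE ?(lt_trans r0)//.
    by rewrite log0 ltNyr.
  by rewrite logE// lte_fin ltr_ln// posrE (lt_trans r0).
Unshelve. all: by end_near. Qed.

Definition eventually_Fconcave (n : nat) F (u : 'rV[R]_n.+1 -> R -> R) : Prop :=
  exists T : R, 0 < T /\ forall t, T <= t -> Fconcave n F (u ^~ t).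

End FConcavity.
Arguments Fconcave {R} n F _.

(* Main.v *)
Require Import Defs.
From mathcomp Require Import all_boot all_order all_algebra.
From mathcomp Require Import all_classical all_reals all_analysis.
From mathcomp Require Import measurable_realfun.
From mathcomp Require Import ring lra.
Import Order.TTheory GRing.Theory Num.Theory.
Import numFieldTopology.Exports numFieldNormedType.Exports.
Local Open Scope classical_set_scope.
Local Open Scope ring_scope.

(** With m the dimension and k = d - m/2 > 0, one has
      ln U(x,t) = k ln (4 pi t) - |x|^2/(4t) + ln A(x),
      A(x) = \int e^(<x,y>/(2t)) e^(-|y|^2/(4t)) phi(y) dy   (tilted phi t x).
    As phi has compact support, Hoeffding's lemma bounds the convexity defect
    of ln A by C |x - y|^2 / t^2, which the concavity of -|x|^2/(4t) absorbs
    for large t: U is eventually log-concave, hence eventually F-concave if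
    F-concavity is weaker than log-concavity.

    Conversely, F-concavity is weaker than log-concavity as soon as the
    function s |-> F (e^s) is concave. Because k > 0, the maximum of ln U(.,t)
    tends to infinity with t, so that ln U reaches given levels a and b on a
    ray, at points at distance of order sqrt (t / ln t). The Hessian of ln U
    being of order 1/t there, ln U is almost affine between them, and the
    F-concavity of U(.,t) gives the concavity inequality of F (e^s) at a and b
    in the limit t -> oo. *)

(** * Lebesgue measurability of half-spaces and coordinates *)

(** Clamping the [i]-th side at [c] cuts the box along a hyperplane; a piece that becomes empty has
    volume zero thanks to the [Num.max 0] in [box_volume]. *)
Lemma box_volume_split {R : realType} {n : nat} (i : 'I_n.+1) (c : R)
    (ab : 'rV[R]_n.+1 * 'rV[R]_n.+1) :
  box_volume (ab.1, \row_j (if j == i then Num.min (ab.2 0 i) c else ab.2 0 j)) +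
  box_volume (\row_j (if j == i then Num.max (ab.1 0 i) c else ab.1 0 j), ab.2) =
  box_volume ab.
Proof.
case: ab => a b; rewrite /box_volume /= (bigD1 i)//= [X in _ + X](bigD1 i)//=.
rewrite [RHS](bigD1 i)//= !mxE eqxx.
rewrite (eq_bigr (fun j => Num.max 0 (b 0 j - a 0 j))); last first.
  by move=> j /negbTE ji; rewrite !mxE ji.
rewrite [X in _ + _ * X](eq_bigr (fun j => Num.max 0 (b 0 j - a 0 j))); last first.
  by move=> j /negbTE ji; rewrite !mxE ji.
rewrite -mulrDl; congr (_ * _); rewrite /Num.min /Num.max.
by repeat case: ifPn; rewrite -?leNgt => *; lra.
Qed.

Section lebesgue_rV_measurable.
Context {R : realType} {n : nat}.
Local Notation E := 'rV[R]_n.+1.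
Local Notation T := (lebesgue_rV_type R n).

(** Caratheodory's criterion: cutting every box of a cover of [X] along [y 0 i = c] yields covers of
    the two parts of [X] with the same total volume. Boxes are open below and closed above, so the
    halves fit the half-space and its complement exactly. *)
Lemma measurable_halfspace (i : 'I_n.+1) (c : R) :
  measurable ([set y : E | y 0 i <= c] : set T).
Proof.
apply: le_caratheodory_measurable => X.
set H := [set y : E | y 0 i <= c].
apply: le_ereal_inf_tmp => _ [B XB <-].
pose Bl k : E * E :=
  ((B k).1, \row_j (if j == i then Num.min ((B k).2 0 i) c else (B k).2 0 j)).
pose Br k : E * E :=
  (\row_j (if j == i then Num.max ((B k).1 0 i) c else (B k).1 0 j), (B k).2).
have -> : (\sum_(0 <= k <oo) (box_volume (B k))%:E =
    \sum_(0 <= k <oo) (box_volume (Bl k))%:E +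
    \sum_(0 <= k <oo) (box_volume (Br k))%:E)%E.
  rewrite -nneseriesD; last 2 first.
  - by move=> k _ _; rewrite lee_fin box_volume_ge0.
  - by move=> k _ _; rewrite lee_fin box_volume_ge0.
  by apply: eq_eseriesr => k _; rewrite -EFinD box_volume_split.
apply: leeD.
- apply: ereal_inf_lbound; exists Bl => // y [Xy Hy].
  have [k _ Bky] := XB y Xy; exists k => // j; have := Bky j.
  rewrite /Bl /= mxE; case: eqP => [->|//] /andP[-> ybi] /=.
  by rewrite le_min ybi.
- apply: ereal_inf_lbound; exists Br => // y [Xy /negP]; rewrite -ltNge => Hy.
  have [k _ Bky] := XB y Xy; exists k => // j; have := Bky j.
  rewrite /Br /= mxE; case: eqP => [->|//] /andP[ayi ->] /=.
  by rewrite gt_max ayi Hy.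
Qed.

Lemma measurable_coord (i : 'I_n.+1) :
  measurable_fun [set: T] ((fun y : E => y 0 i) : T -> R).
Proof.
apply: (measurability (@RGenOInfty.G R)).
  exact: RGenOInfty.measurableE.
move=> _ [_ [c ->] <-]; rewrite setTI.
have -> : ((fun y : E => y 0 i) @^-1` `]c, +oo[ = ~` [set y : E | y 0 i <= c])%classic.
  apply/seteqP; split => y /=; rewrite in_itv/= andbT ltNge.
    by move/negP.
  by move/negP.
exact: measurableC (measurable_halfspace i c).
Qed.

Lemma lebesgue_rV_box_lty (ab : E * E) : (lebesgue_rV R n (box ab) < +oo)%E.
Proof.
apply: (@le_lt_trans _ _ (box_volume ab)%:E); last exact: ltry.
apply: ereal_inf_lbound => /=.
exists (fun k => if k == 0%N then ab else (0, 0) : E * E).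
  by move=> y aby; exists 0%N.
rewrite (@nneseriesD1 _ _ 0%N)//; last first.
  by move=> k _; rewrite lee_fin box_volume_ge0.
rewrite eseries0 ?adde0// => -[|k] _ //= _.
by rewrite /box_volume big_ord_recl !mxE subrr maxxx mul0r.
Qed.

End lebesgue_rV_measurable.

(** * Exponential moments and Hoeffding's inequality *)

(** For [u <= 1/2], [1 - u <= e^(-u)] gives [e^u <= 1 / (1 - u) <= 1 + u + 2 u^2]; for larger [u],
    already [u <= 2 u^2]. *)
Lemma expR_le_quadratic {R : realType} (u : R) : expR u <= u + expR (2 * u ^+ 2).
Proof.
have [u2|u2] := leP u (1 / 2).
  have h1 : expR u <= 1 + u + 2 * u ^+ 2.
    have := expR_ge1Dx (- u); rewrite expRN => h.
    have e0 := expR_gt0 u.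
    have : (1 - u) * expR u <= 1.
      by have := ler_wpM2r (ltW e0) h; rewrite mulVf ?gt_eqF.
    by nra.
  by have := expR_ge1Dx (2 * u ^+ 2); lra.
have : expR u <= expR (2 * u ^+ 2) by rewrite ler_expR; nra.
by lra.
Qed.

Section exponential_moments.
Context {d : measure_display} {T : measurableType d} {R : realType}.
Variables (mu : {measure set T -> \bar R}) (psi : T -> R).
Hypothesis psi_ge0 : forall y, 0 <= psi y.
Hypothesis psi_int : mu.-integrable [set: T] (EFin \o psi).

(** The bound is asked only where [psi] is nonzero: linear functions are unbounded on R^n but
    bounded on the support of a datum. *)
Lemma integrable_bounded_on_support (g : T -> R) (K : R) :
  measurable_fun [set: T] g -> (forall y, psi y != 0 -> `|g y| <= K) ->
  mu.-integrable [set: T] (EFin \o (fun y => g y * psi y)).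
Proof.
move=> mg gK; apply: (le_integrable measurableT) (integrableZl measurableT K psi_int).
  apply/measurable_EFinP/measurable_funM => //.
  by apply/measurable_EFinP; exact: measurable_int psi_int.
move=> y _ /=; rewrite lee_fin !normrM.
have [->|py] := eqVneq (psi y) 0; first by rewrite normr0 !mulr0.
by rewrite ler_wpM2r// (le_trans (gK _ py))// ler_norm.
Qed.

Variables (X : T -> R) (r : R).
Hypothesis mX : measurable_fun [set: T] X.
Hypothesis Xr : forall y, psi y != 0 -> `|X y| <= r.

Lemma integrable_expR (s : R) :
  mu.-integrable [set: T] (EFin \o (fun y => expR (s * X y) * psi y)).
Proof.
apply: (@integrable_bounded_on_support _ (expR (`|s| * r))).
  by apply: measurableT_comp; [exact: measurable_expR|exact: measurable_funM].
move=> y /Xr yr; rewrite gtr0_norm ?expR_gt0// ler_expR.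
by rewrite (le_trans (ler_norm _))// normrM ler_wpM2l.
Qed.

Lemma Rintegral_expR_bounds :
  expR (- r) * \int[mu]_y psi y <= \int[mu]_y (expR (X y) * psi y)
    <= expR r * \int[mu]_y psi y.
Proof.
have iX : mu.-integrable [set: T] (EFin \o (fun y => expR (X y) * psi y)).
  by have := integrable_expR 1; under eq_fun do rewrite mul1r.
have icst c : mu.-integrable [set: T] (EFin \o (fun y => c * psi y)).
  exact: (integrableZl measurableT c psi_int).
rewrite -!RintegralZl//; apply/andP; split; apply: le_Rintegral => // y _.
- have [->|/Xr] := eqVneq (psi y) 0; first by rewrite !mulr0.
  by rewrite ler_norml => /andP[yr _]; rewrite ler_wpM2r// ler_expR.
- have [->|/Xr] := eqVneq (psi y) 0; first by rewrite !mulr0.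
  by rewrite ler_norml => /andP[_ yr]; rewrite ler_wpM2r// ler_expR.
Qed.

Hypothesis psi_gt0 : 0 < \int[mu]_y psi y.

Lemma Rintegral_expR_gt0 : 0 < \int[mu]_y (expR (X y) * psi y).
Proof.
have /andP[+ _] := Rintegral_expR_bounds; apply: lt_le_trans.
by rewrite mulr_gt0 ?expR_gt0.
Qed.

(* Hoeffding's lemma, up to the constant: [e^u <= u + e^(2 u^2)] is applied to
   [u = s (X - E X)], whose linear part integrates to zero. *)
Lemma Rintegral_expR_le (s : R) :
  \int[mu]_y (expR (s * X y) * psi y) <= (\int[mu]_y psi y) *
    expR (s * ((\int[mu]_y (X y * psi y)) / \int[mu]_y psi y) + 8 * (s * r) ^+ 2).
Proof.
have N0 := psi_gt0; set N := \int[mu]_y psi y in N0 *.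
set J := \int[mu]_y (X y * psi y); set m := J / N.
have iX : mu.-integrable [set: T] (EFin \o (fun y => X y * psi y)).
  exact: integrable_bounded_on_support Xr.
have icst c : mu.-integrable [set: T] (EFin \o (fun y => c * psi y)).
  exact: (integrableZl measurableT c psi_int).
have mJ : m * N = J by rewrite /m divfK ?gt_eqF.
(* The mean [m] obeys the bound of [X]; hence [(X - m)^2 <= 4 r^2], and the exponent [2 u^2] is at
   most [8 (s r)^2]. *)
have mr : `|m| <= r.
  rewrite /m normf_div (gtr0_norm N0) ler_pdivrMr//.
  apply: (le_trans (le_normr_Rintegral _ _)) => //.
  rewrite -RintegralZl//; apply: le_Rintegral => // [|y _].
    exact: integrable_norm.
  rewrite normrM (ger0_norm (psi_ge0 _)).
  have [->|/Xr yr] := eqVneq (psi y) 0; first by rewrite !mulr0.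
  by rewrite ler_wpM2r.
have key : \int[mu]_y (expR (- (s * m)) * (expR (s * X y) * psi y)) <=
    \int[mu]_y (s * (X y * psi y) +
                (expR (8 * (s * r) ^+ 2) - s * m) * psi y).
  apply: le_Rintegral => //.
  - exact: (integrableZl measurableT _ (integrable_expR s)).
  - exact: (integrableD measurableT (integrableZl measurableT s iX) (icst _)).
  move=> y _; have [->|/Xr yr] := eqVneq (psi y) 0; first by rewrite !mulr0 addr0.
  rewrite mulrA -expRD mulrA -mulrDl ler_wpM2r//.
  rewrite (_ : - (s * m) + s * X y = s * (X y - m)); last by ring.
  apply: (le_trans (expR_le_quadratic _)).
  suff : expR (2 * (s * (X y - m)) ^+ 2) <= expR (8 * (s * r) ^+ 2) by lra.
  rewrite ler_expR !exprMn.
  have : (X y - m) ^+ 2 <= 4 * r ^+ 2.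
    move: yr mr; rewrite !ler_norml => /andP[? ?] /andP[? ?].
    by nra.
  by have := sqr_ge0 s; nra.
move: key; rewrite RintegralZl//; last exact: integrable_expR.
rewrite RintegralD//; last exact: (integrableZl measurableT s iX).
rewrite !RintegralZl// -/J -/N -mJ.
rewrite (_ : s * (m * N) + _ = N * expR (8 * (s * r) ^+ 2)); last by ring.
rewrite expRN mulrC ler_pdivrMr ?expR_gt0// -mulrA -expRD.
by rewrite (addrC (8 * _)).
Qed.

End exponential_moments.

(** Hoeffding's bound is used at [s = - p] and [s = 1 - p]. With weights [1 - p] and [p] the terms
    in the mean cancel, and the squares add up to [(1 - p) p^2 + p (1 - p)^2 = p (1 - p)]. *)
Lemma ln_Rintegral_expR_semiconcave {d : measure_display} {T : measurableType d}
    {R : realType} {mu : {measure set T -> \bar R}} {psi X : T -> R} {r p : R} :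
  (forall y, 0 <= psi y) -> mu.-integrable [set: T] (EFin \o psi) ->
  measurable_fun [set: T] X -> (forall y, psi y != 0 -> `|X y| <= r) ->
  0 < \int[mu]_y psi y -> 0 <= p <= 1 ->
  (1 - p) * ln (\int[mu]_y (expR (- p * X y) * psi y)) +
  p * ln (\int[mu]_y (expR ((1 - p) * X y) * psi y)) <=
  ln (\int[mu]_y psi y) + 8 * (p * (1 - p) * r ^+ 2).
Proof.
move=> psi0 ipsi mX Xr N0 /andP[p0 p1].
set N := \int[mu]_y psi y in N0 *.
set m := (\int[mu]_y (X y * psi y)) / N.
have H s : ln (\int[mu]_y (expR (s * X y) * psi y)) <=
    ln N + (s * m + 8 * (s * r) ^+ 2).
  have I0 : 0 < \int[mu]_y (expR (s * X y) * psi y).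
    apply: (@Rintegral_expR_gt0 _ _ _ _ _ psi0 ipsi _ (`|s| * r)) => //.
      exact: measurable_funM.
    by move=> y /Xr yr; rewrite normrM ler_wpM2l.
  rewrite -[in leRHS](expRK (s * m + _)) -lnM ?posrE ?expR_gt0//.
  rewrite ler_ln ?posrE ?mulr_gt0 ?expR_gt0//.
  exact: Rintegral_expR_le.
have := ler_wpM2l p0 (H (1 - p)).
have p1' : 0 <= 1 - p by lra.
have := ler_wpM2l p1' (H (- p)).
move=> h1 h2; apply: le_trans (lerD h1 h2) _.
by rewrite !exprMn sqrrN; nra.
Qed.

(** * Factorisation of the heat flow into a Gaussian and a tilted integral *)

Section gaussian_tilting.
Context {R : realType} {n : nat}.
Local Notation E := 'rV[R]_n.+1.
Local Notation T := (lebesgue_rV_type R n).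
Implicit Types (x y h : E) (t : R).

Definition dotrV x y : R := \sum_(i < n.+1) x 0 i * y 0 i.

Lemma sqnorm_ge0 x : 0 <= sqnorm x.
Proof. by apply: sumr_ge0 => i _; exact: sqr_ge0. Qed.

Lemma sqnormB x y : sqnorm (x - y) = sqnorm x - 2 * dotrV x y + sqnorm y.
Proof.
rewrite /sqnorm /dotrV mulr_sumr -sumrB -big_split /=.
by apply: eq_bigr => i _; rewrite !mxE; ring.
Qed.

Lemma dotrVDl x h y (s : R) : dotrV (x + s *: h) y = dotrV x y + s * dotrV h y.
Proof.
rewrite /dotrV mulr_sumr -big_split /=.
by apply: eq_bigr => i _; rewrite !mxE; ring.
Qed.

Lemma sqnorm_convex x y (p : R) :
  (1 - p) * sqnorm x + p * sqnorm y =
  sqnorm ((1 - p) *: x + p *: y) + p * (1 - p) * sqnorm (y - x).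
Proof.
rewrite /sqnorm !mulr_sumr -!big_split /=.
by apply: eq_bigr => i _; rewrite !mxE; ring.
Qed.

Lemma ler_norm_dotrV h y (r : R) : (forall i, `|y 0 i| <= r) ->
  `|dotrV h y| <= n.+1%:R * (Num.sqrt (sqnorm h) * r).
Proof.
move=> yr; rewrite (le_trans (ler_norm_sum _ _ _))//.
have -> : n.+1%:R * (Num.sqrt (sqnorm h) * r) =
    \sum_(i < n.+1) (Num.sqrt (sqnorm h) * r).
  by rewrite sumr_const card_ord mulr_natl.
apply: ler_sum => i _; rewrite normrM ler_pM//.
rewrite -sqrtr_sqr ler_wsqrtr// /sqnorm (bigD1 i)//= lerDl.
by apply: sumr_ge0 => j _; exact: sqr_ge0.
Qed.

Lemma measurable_dotrV h : measurable_fun [set: T] (dotrV h : T -> R).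
Proof.
apply: measurable_sum => i; apply: measurable_funM => //.
exact: measurable_coord.
Qed.

Lemma measurable_sqnorm : measurable_fun [set: T] (sqnorm : T -> R).
Proof. by apply: measurable_sum => i; apply: measurable_funX; exact: measurable_coord. Qed.

Variable phi : E -> R.
Hypothesis phiL : heat_datum phi.

Lemma heat_datum_bounded_support :
  exists2 r, 0 < r & forall y, phi y != 0 -> forall i, `|y 0 i| <= r.
Proof.
have [r r0 yr] := pinfty_ex_gt0 (compact_bounded (heat_datum_support phiL)).
exists r => // y y0 i.
have := yr y (@subset_closure _ _ y y0).
rewrite /= [`|y|]mx_normrE; apply: le_trans.
exact: (le_bigmax _ (fun j : 'I_1 * 'I_n.+1 => `|y j.1 j.2|) (0, i)).
Qed.

Lemma heat_datum_integrable :
  (lebesgue_rV R n).-integrable [set: T] (EFin \o (phi : T -> R)).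
Proof.
have [r r0 yr] := heat_datum_bounded_support.
have [M phiM] := heat_datum_bounded phiL.
(* Boxes exclude their lower faces, hence [- r - 1] rather than [- r]. *)
pose B : set T := box (const_mx (- r - 1), const_mx r).
have mB : measurable B.
  have -> : B = \bigcap_(i in [set: 'I_n.+1])
      ((fun y : E => y 0 i) @^-1` `]- r - 1, r]%classic).
    apply/seteqP; split => y /=.
      by move=> By i _ /=; have := By i; rewrite !mxE in_itv.
    by move=> By i; have := By i I; rewrite /= in_itv/= !mxE.
  apply: fin_bigcap_measurable => [|i _]; first exact: finite_finset.
  rewrite -[X in measurable X]setTI.
  by apply: measurable_coord => //; exact: measurable_itv.
have : (lebesgue_rV R n).-integrable B (EFin \o (phi : T -> R)).
  apply: measurable_bounded_integrable => //.
  - exact: lebesgue_rV_box_lty.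
  - exact: measurable_funS (heat_datum_measurable phiL).
  - exists M; split; first exact: num_real.
    move=> K MK y _ /=; rewrite ger0_norm ?(heat_datum_ge0 phiL)//.
    exact: le_trans (phiM y) (ltW MK).
move/(integrable_mkcond _ mB); apply: eq_integrable => // y _.
rewrite patchE; case: ifPn => // /negP yB.
apply/esym/eqP; rewrite /= eqe; apply: contra_notT yB => y0; rewrite inE => i.
by have := yr y y0 i; rewrite !mxE ler_norml => /andP[h ->]; rewrite andbT; lra.
Qed.

Lemma heat_datum_Rintegral_gt0 :
  0 < \int[lebesgue_rV R n]_(y in [set: T]) phi y.
Proof.
rewrite lt_neqAle Rintegral_ge0 ?andbT; last first.
  by move=> y _; exact: (heat_datum_ge0 phiL).
apply/negP => /eqP/esym I0; apply: (heat_datum_nontrivial phiL).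
have /integrableP[mphi _] := heat_datum_integrable.
have /(ae_eq_integral_abs _ measurableT mphi) :
    (\int[lebesgue_rV R n]_(y in [set: T]) `|(phi y)%:E|)%E = 0%E.
  under eq_integral do rewrite gee0_abs ?lee_fin ?(heat_datum_ge0 phiL)//.
  rewrite -[LHS]fineK; first by rewrite -[fine _]/(Rintegral _ _ _) I0.
  exact: integrable_fin_num heat_datum_integrable.
by apply: filterS => y /(_ I) [].
Qed.

Definition gaussian_datum t : T -> R := fun y => expR (- sqnorm y / (4 * t)) * phi y.

Definition tilted t x : R :=
  \int[lebesgue_rV R n]_y (expR (dotrV x y / (2 * t)) * gaussian_datum t y).

Lemma measurable_dotrVZ h (s : R) :
  measurable_fun [set: T] ((fun y => dotrV h y / s) : T -> R).
Proof. by apply: measurable_funM => //; exact: measurable_dotrV. Qed.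

Lemma gaussian_datum_ge0 t y : 0 <= gaussian_datum t y.
Proof. by rewrite mulr_ge0 ?expR_ge0 ?(heat_datum_ge0 phiL). Qed.

Lemma gaussian_datum_neq0 t y : gaussian_datum t y != 0 -> phi y != 0.
Proof. by rewrite mulf_eq0 negb_or => /andP[]. Qed.

Lemma measurable_gaussian_exponent t :
  measurable_fun [set: T] ((fun y => - sqnorm y / (4 * t)) : T -> R).
Proof.
apply: measurable_funM => //; apply: measurable_funN; exact: measurable_sqnorm.
Qed.

Lemma ler_dotrVZ (r t : R) h y : 0 < t ->
  (forall y, phi y != 0 -> forall i, `|y 0 i| <= r) -> phi y != 0 ->
  `|dotrV h y / (2 * t)| <= n.+1%:R * (Num.sqrt (sqnorm h) * r) / (2 * t).
Proof.
move=> t0 supp py.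
have t2 : 0 < 2 * t by rewrite mulr_gt0.
rewrite normrM (gtr0_norm (x := (2 * t)^-1)) ?invr_gt0//.
by rewrite ler_pM2r ?invr_gt0//; apply: ler_norm_dotrV => i; exact: supp.
Qed.

Lemma ler_gaussian_exponent (r t : R) y : 0 < t ->
  (forall y, phi y != 0 -> forall i, `|y 0 i| <= r) -> phi y != 0 ->
  `|- sqnorm y / (4 * t)| <= n.+1%:R * r ^+ 2 / (4 * t).
Proof.
move=> t0 supp py.
have t4 : 0 < 4 * t by rewrite mulr_gt0.
rewrite mulNr normrN normrM (gtr0_norm (x := (4 * t)^-1)) ?invr_gt0//.
rewrite ler_pM2r ?invr_gt0// ger0_norm ?sqnorm_ge0//.
have -> : n.+1%:R * r ^+ 2 = \sum_(i < n.+1) r ^+ 2.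
  by rewrite sumr_const card_ord mulr_natl.
apply: ler_sum => i _; rewrite -real_normK ?num_real// ler_pXn2r ?nnegrE//.
  exact: supp.
exact: le_trans (supp y py i).
Qed.

Lemma integrable_gaussian_datum t : 0 < t ->
  (lebesgue_rV R n).-integrable [set: T] (EFin \o gaussian_datum t).
Proof.
move=> t0; have [r r0 supp] := heat_datum_bounded_support.
apply: (@integrable_bounded_on_support _ _ _ _ _ heat_datum_integrable _ 1).
  apply: measurableT_comp; first exact: measurable_expR.
  exact: measurable_gaussian_exponent.
move=> y _; rewrite ger0_norm ?expR_ge0// -expR0 ler_expR mulNr oppr_le0.
by rewrite divr_ge0 ?sqnorm_ge0// mulr_ge0// ltW.
Qed.

Lemma integrable_tilted t x : 0 < t ->
  (lebesgue_rV R n).-integrable [set: T]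
    (EFin \o (fun y => expR (dotrV x y / (2 * t)) * gaussian_datum t y)).
Proof.
move=> t0; have [r r0 supp] := heat_datum_bounded_support.
have := @integrable_expR _ _ _ _ _ (integrable_gaussian_datum _ t0) _
  (n.+1%:R * (Num.sqrt (sqnorm x) * r) / (2 * t)) (measurable_dotrVZ x (2 * t)) _ 1.
under eq_fun do rewrite mul1r.
by apply=> y /gaussian_datum_neq0; exact: ler_dotrVZ.
Qed.

(** With [r] a bound for the coordinates on the support of [phi], this dominates the exponent
    [dotrV x y / (2 t) - sqnorm y / (4 t)] there; it tends to zero as [t] grows if the norm of [x]
    is [o(t)]. *)
Definition tilt_error (r t : R) x : R :=
  n.+1%:R * (Num.sqrt (sqnorm x) * r) / (2 * t) + n.+1%:R * r ^+ 2 / (4 * t).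

Lemma tilted_bounds (r t : R) x : 0 < t ->
  (forall y, phi y != 0 -> forall i, `|y 0 i| <= r) ->
  expR (- tilt_error r t x) * \int[lebesgue_rV R n]_(y in [set: T]) phi y <=
    tilted t x <=
  expR (tilt_error r t x) * \int[lebesgue_rV R n]_(y in [set: T]) phi y.
Proof.
move=> t0 supp.
(* The Gaussian weight joins the exponent, so that both bounds involve the mass of [phi], which does
   not depend on [t]. *)
have -> : tilted t x = \int[lebesgue_rV R n]_(y in [set: T])
    (expR (dotrV x y / (2 * t) + - sqnorm y / (4 * t)) * phi y).
  by apply: eq_Rintegral => y _; rewrite /gaussian_datum expRD mulrA.
apply: Rintegral_expR_bounds.
- exact: heat_datum_ge0 phiL.
- exact: heat_datum_integrable.
- apply: measurable_funD; first exact: measurable_dotrVZ.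
  exact: measurable_gaussian_exponent.
move=> y py; rewrite (le_trans (ler_normD _ _))// lerD//.
  exact: ler_dotrVZ.
exact: ler_gaussian_exponent.
Qed.

Lemma tilted_gt0 t x : 0 < t -> 0 < tilted t x.
Proof.
move=> t0; have [r r0 supp] := heat_datum_bounded_support.
have /andP[+ _] := tilted_bounds _ _ x t0 supp; apply: lt_le_trans.
by rewrite mulr_gt0 ?expR_gt0 ?heat_datum_Rintegral_gt0.
Qed.

(** Expanding [|x - y|^2] pulls [e^(-|x|^2 / (4 t))] out of the heat integral and leaves the
    exponent of [tilted]; the two powers of [4 pi t] combine. *)
Lemma UE (d t : R) x : 0 < t -> U d phi x t =
  expR ((d - n.+1%:R / 2) * ln (4 * pi * t) - sqnorm x / (4 * t)) * tilted t x.
Proof.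
move=> t0; have p0 : 0 < 4 * pi * t by rewrite !mulr_gt0 ?pi_gt0.
rewrite /U /heat.
have -> : \int[lebesgue_rV R n]_(y in [set: E])
    (expR (- sqnorm (x - y) / (4 * t)) * phi y) =
    expR (- (sqnorm x / (4 * t))) * tilted t x.
  rewrite /tilted -RintegralZl//; last exact: integrable_tilted.
  apply: eq_Rintegral => y _; rewrite /gaussian_datum !mulrA -!expRD.
  congr (expR _ * _); rewrite sqnormB; field.
  by rewrite gt_eqF.
by rewrite /powR gt_eqF// !mulrA -!expRD; congr (expR _ * _); ring.
Qed.

Lemma U_gt0 (d t : R) x : 0 < t -> 0 < U d phi x t.
Proof. by move=> t0; rewrite UE// mulr_gt0 ?expR_gt0 ?tilted_gt0. Qed.

Lemma ln_U (d t : R) x : 0 < t -> ln (U d phi x t) =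
  (d - n.+1%:R / 2) * ln (4 * pi * t) - sqnorm x / (4 * t) + ln (tilted t x).
Proof.
by move=> t0; rewrite UE// lnM ?posrE ?expR_gt0 ?tilted_gt0// expRK.
Qed.

(** On the line through [x] and [y] with origin [c], [tilted] is the moment generating function of
    [dotrV h / (2 t)] for the density tilted at [c]; [x] and [y] are its values at [s = - p] and
    [s = 1 - p]. *)
Lemma ln_tilted_semiconcave (r t p : R) (x y : E) : 0 < t ->
  (forall y, phi y != 0 -> forall i, `|y 0 i| <= r) -> 0 <= p <= 1 ->
  (1 - p) * ln (tilted t x) + p * ln (tilted t y) <=
  ln (tilted t ((1 - p) *: x + p *: y)) +
  2 * (p * (1 - p) * (n.+1%:R * r / t) ^+ 2 * sqnorm (y - x)).
Proof.
move=> t0 supp p01; set c := (1 - p) *: x + p *: y; set h := y - x.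
have tiltE (s : R) : tilted t (c + s *: h) = \int[lebesgue_rV R n]_z
    (expR (s * (dotrV h z / (2 * t))) *
     (expR (dotrV c z / (2 * t)) * gaussian_datum t z)).
  apply: eq_Rintegral => z _; rewrite mulrA -expRD dotrVDl.
  by congr (expR _ * _); rewrite mulrDl addrC mulrA.
have -> : tilted t x = tilted t (c + (- p) *: h).
  by congr tilted; apply/rowP => i; rewrite !mxE; ring.
have -> : tilted t y = tilted t (c + (1 - p) *: h).
  by congr tilted; apply/rowP => i; rewrite !mxE; ring.
rewrite !tiltE.
(* [r'] bounds [dotrV h / (2 t)] on the support of [phi]; its denominator turns the constant 8 into
   2. *)
set r' := n.+1%:R * (Num.sqrt (sqnorm h) * r) / (2 * t).
have -> : 2 * (p * (1 - p) * (n.+1%:R * r / t) ^+ 2 * sqnorm h) =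
    8 * (p * (1 - p) * r' ^+ 2).
  rewrite -(sqr_sqrtr (sqnorm_ge0 h)) /r'; field.
  by rewrite gt_eqF.
apply: ln_Rintegral_expR_semiconcave => //.
- by move=> z; rewrite mulr_ge0 ?expR_ge0 ?gaussian_datum_ge0.
- exact: integrable_tilted.
- exact: measurable_dotrVZ.
- move=> z; rewrite mulf_eq0 negb_or => /andP[_ /gaussian_datum_neq0].
  exact: ler_dotrVZ.
- exact: tilted_gt0.
Qed.

End gaussian_tilting.

(** * Eventual log-concavity *)

Lemma Fconcave_log_gt0 {R : realType} {n : nat} (u : 'rV[R]_n.+1 -> R) :
  (forall x, 0 < u x) ->
  (forall x y p, 0 < p < 1 -> (1 - p) * ln (u x) + p * ln (u y) <=
    ln (u ((1 - p) *: x + p *: y))) ->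
  Fconcave n log u.
Proof.
move=> u0 uconc; split=> [x|x y p p01]; first exact/ltW.
by rewrite !logE ?u0// -!EFinM -EFinD lee_fin; exact: uconc.
Qed.

(** By [sqnorm_convex] the Gaussian term gains [p (1 - p) sqnorm (y - x) / (4 t)], and the defect of
    [A] is at most [8 t K^2 <= 1] times this gain. *)
Lemma Fconcave_log_gaussian {R : realType} {n : nat} (u A : 'rV[R]_n.+1 -> R)
    (t k K : R) : 0 < t -> 8 * (t * K ^+ 2) <= 1 ->
  (forall x, 0 < u x) ->
  (forall x, ln (u x) = k - sqnorm x / (4 * t) + A x) ->
  (forall p x y, 0 <= p <= 1 -> (1 - p) * A x + p * A y <=
    A ((1 - p) *: x + p *: y) + 2 * (p * (1 - p) * K ^+ 2 * sqnorm (y - x))) ->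
  Fconcave n log u.
Proof.
move=> t0 tK u0 uE Aconc; apply: Fconcave_log_gt0 => // x y p /andP[p0 p1].
rewrite !uE; have p01 : 0 <= p <= 1 by rewrite !ltW.
have := Aconc p x y p01.
have := sqnorm_convex x y p; have := sqnorm_ge0 (y - x).
set c := (1 - p) *: x + p *: y; set D := sqnorm (y - x) => D0 Q H.
have Dt : 2 * (p * (1 - p) * K ^+ 2 * D) <= p * (1 - p) * D / (4 * t).
  have -> : 2 * (p * (1 - p) * K ^+ 2 * D) =
      (8 * (t * K ^+ 2)) * (p * (1 - p) * D / (4 * t)).
    by field; rewrite gt_eqF.
  by rewrite ler_piMl// divr_ge0 ?mulr_ge0 ?subr_ge0 ?(ltW t0)// ltW.
have {}Q : (1 - p) * (sqnorm x / (4 * t)) + p * (sqnorm y / (4 * t)) =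
    sqnorm c / (4 * t) + p * (1 - p) * D / (4 * t).
  by rewrite !mulrA -!mulrDl Q.
by lra.
Qed.

Lemma Fconcave_log_U {R : realType} {n : nat} (phi : 'rV[R]_n.+1 -> R) (d : R) :
  heat_datum phi ->
  exists T : R, 0 < T /\ forall t, T <= t -> Fconcave n log ((U d phi) ^~ t).
Proof.
move=> phiL; have [r r0 supp] := heat_datum_bounded_support _ phiL.
(* With [K = n.+1 r / t], the condition [8 t K^2 <= 1] reads [t >= 8 (n.+1 r)^2]. *)
exists (8 * (n.+1%:R * r) ^+ 2); split.
  by rewrite mulr_gt0 ?exprn_gt0 ?mulr_gt0.
move=> t Tt; have t0 : 0 < t.
  by apply: lt_le_trans Tt; rewrite mulr_gt0 ?exprn_gt0 ?mulr_gt0.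
apply: (@Fconcave_log_gaussian _ _ _ (fun x => ln (tilted phi t x)) t
  ((d - n.+1%:R / 2) * ln (4 * pi * t)) (n.+1%:R * r / t) t0).
- rewrite expr_div_n (_ : 8 * _ = 8 * (n.+1%:R * r) ^+ 2 / t).
    by rewrite ler_pdivrMr// mul1r.
  by field; rewrite gt_eqF.
- by move=> x; exact: (U_gt0 _ phiL d t x t0).
- by move=> x; exact: (ln_U _ phiL d t x t0).
- by move=> p x y p01; exact: (ln_tilted_semiconcave _ phiL r t p x y t0 supp p01).
Qed.

(** * Reduction to the concavity of [F (e^s)] *)

(** Where positive, a log-concave [f] is the exponential of a concave function, and the concavity
    and monotonicity of [F (expR s)] transfer the inequality. If [f x] or [f y] is zero, [F 0 = -oo]
    makes the left side [-oo]. *)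
Lemma weaker_concavity_log {R : realType} (n : nat) (F : R -> \bar R) :
  admissible F ->
  (forall a b p : R, 0 < p < 1 ->
    ((1 - p)%:E * F (expR a) + p%:E * F (expR b) <=
      F (expR ((1 - p) * a + p * b)))%E) ->
  weaker_concavity n F log.
Proof.
move=> [Flty Fcont Fincr F0] Fexp f [f0 fconc]; split=> // x y p p01.
have /andP[p0 p1] := p01; have q0 : 0 < 1 - p by rewrite subr_gt0.
have := f0 x; rewrite le_eqVlt => /predU1P[<-|fx0].
  by rewrite F0 gt0_muleNy ?lte_fin// addNye leNye.
have := f0 y; rewrite le_eqVlt => /predU1P[<-|fy0].
  by rewrite F0 gt0_muleNy ?lte_fin// addeNy leNye.
have := fconc x y p p01; set z := ((1 - p) *: x + p *: y)%R.
(* Log-concavity excludes [f z = 0], since [log (f x)] and [log (f y)] are now finite. *)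
have := f0 z; rewrite le_eqVlt => /predU1P[<-|fz0].
  by rewrite log0 !logE// -!EFinM -EFinD leeNy_eq.
rewrite !logE// -!EFinM -EFinD lee_fin => lnz.
have := Fexp (ln (f x)) (ln (f y)) p p01; rewrite !lnK ?posrE//.
move=> /le_trans; apply; rewrite -[f z]lnK ?posrE//.
move: lnz; rewrite le_eqVlt => /predU1P[->//|lnz].
by apply/ltW/Fincr; rewrite ?expR_ge0// ltr_expR.
Qed.

(** * Almost affine profiles of [ln U] at large times *)

(** This supplies the time: the vertex [k ln (4 pi t) + C] of the parabola must reach a given level
    while staying small compared with [t]. *)
Lemma affine_ln_sublinear {R : realType} (k C L T eta : R) : 0 < k -> 0 < eta ->
  exists t : R, [/\ T <= t, 0 < t, L <= k * ln (4 * pi * t) + C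
                  & k * ln (4 * pi * t) + C <= eta * t].
Proof.
move=> k0 eta0; have p0 : 0 < 4 * pi :> R by rewrite mulr_gt0 ?pi_gt0.
(* The time is given by [4 pi t = e^w]. The summands after 1 yield in turn [T <= t] through
   [1 + w <= e^w], the level [L] through [|L - C| <= k w], and the upper bound through
   [w^2 / 4 <= e^w]. *)
pose w : R := 1 + 4 * pi * `|T| + `|L - C| / k + 4 * (4 * pi) * (k + `|C|) / eta.
have a1 : 0 <= 4 * pi * `|T| by rewrite mulr_ge0// ltW.
have a2 : 0 <= `|L - C| / k by rewrite divr_ge0// ltW.
have a3 : 0 <= 4 * (4 * pi) * (k + `|C|) / eta.
  apply: divr_ge0; last exact: ltW.
  by apply: mulr_ge0; [lra | rewrite addr_ge0// ltW].
have w1 : 1 <= w by rewrite /w; lra.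
exists (expR w / (4 * pi)).
have -> : 4 * pi * (expR w / (4 * pi)) = expR w by rewrite mulrCA mulfV ?mulr1// gt_eqF.
rewrite expRK; split.
- rewrite ler_pdivlMr//; have := expR_ge1Dx w.
  have : T * (4 * pi) <= 4 * pi * `|T| by rewrite mulrC ler_pM2l// ler_norm.
  by rewrite /w; lra.
- by rewrite divr_gt0 ?expR_gt0.
- have : `|L - C| <= k * w.
    rewrite mulrC -ler_pdivrMr//; rewrite /w; lra.
  by have := ler_norm (L - C); lra.
- have ew : w ^+ 2 / 4 <= expR w.
    rewrite [expR w](_ : _ = expR (w / 2) ^+ 2); last first.
      by rewrite expr2 -expRD; congr expR; lra.
    by have := expR_ge1Dx (w / 2); nra.
  have : k * w + C <= (k + `|C|) * w.
    by have := ler_norm C; have := normr_ge0 C; nra.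
  move=> /le_trans; apply.
  have : 4 * (4 * pi) * (k + `|C|) <= eta * w.
    by rewrite mulrC -[leRHS]mulrC -ler_pdivrMr// mulrC /w; lra.
  rewrite [in X in _ -> X]mulrA ler_pdivlMr// => h.
  have : eta * (w ^+ 2 / 4) <= eta * expR w by rewrite ler_pM2l.
  by nra.
Qed.

Lemma sqnorm_delta {R : realType} {n : nat} (s : R) :
  sqnorm (s *: delta_mx 0 0 : 'rV[R]_n.+1) = s ^+ 2.
Proof.
rewrite /sqnorm (bigD1 0)//= !mxE !eqxx mulr1 big1 ?addr0// => i /negbTE i0.
by rewrite !mxE i0 mulr0 expr0n.
Qed.

(** With [ln_U], this places [ln U] within [tilt_error] of a paraboloid centred at the origin. *)
Lemma ln_tilted_bounds {R : realType} {n : nat} (phi : 'rV[R]_n.+1 -> R)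
    (r t : R) (x : 'rV[R]_n.+1) : heat_datum phi -> 0 < t ->
  (forall y, phi y != 0 -> forall i, `|y 0 i| <= r) ->
  `|ln (tilted phi t x) - ln (\int[lebesgue_rV R n]_(y in setT) phi y)| <=
    tilt_error r t x.
Proof.
move=> phiL t0 supp.
have := heat_datum_Rintegral_gt0 _ phiL.
have := tilted_gt0 _ phiL t x t0.
have := tilted_bounds _ phiL r t x t0 supp.
move: (tilted phi t x) (Rintegral _ _ _) (tilt_error r t x) => A M B.
move=> /andP[h1 h2] A0 M0; rewrite ler_distl; apply/andP; split.
  rewrite -[B]expRK -lnV ?posrE ?expR_gt0// -lnM ?posrE ?invr_gt0 ?expR_gt0//.
  by rewrite ler_ln ?posrE ?mulr_gt0 ?invr_gt0 ?expR_gt0// -expRN mulrC.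
rewrite -[B]expRK -lnM ?posrE ?expR_gt0//.
by rewrite ler_ln ?posrE ?mulr_gt0 ?expR_gt0// mulrC.
Qed.

(* [g] stands for [ln U] along a ray; [sa] and [sb] are the points where the
   parabola [L - s^2 / (4 t)] takes the values [a] and [b]. *)
Lemma almost_affine_levels {R : realType} (t L eps K a b p : R) (g : R -> R) :
  0 < t -> 0 < eps -> 0 <= K -> 0 < p < 1 ->
  (forall s, `|g s - (L - s ^+ 2 / (4 * t))| <= K * `|s| / t + eps / 4) ->
  1 + `|a| <= L -> `|b| <= L -> 2 * (b - a) ^+ 2 <= eps * (L - a) ->
  64 * K ^+ 2 * (L + `|a| + `|b|) <= eps ^+ 2 * t ->
  exists sa sb, [/\ a - eps <= g sa, b - eps <= g sb &
    g ((1 - p) * sa + p * sb) <= (1 - p) * a + p * b + eps].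
Proof.
move=> t0 eps0 K0 /andP[p0 p1] gP La Lb Lab LK.
have t4 : 0 < 4 * t by lra.
have La' : 1 <= L - a by have := ler_norm a; lra.
have Lb' : 0 <= L - b by have := ler_norm b; lra.
have na : - a <= `|a| by rewrite -normrN ler_norm.
have nb : - b <= `|b| by rewrite -normrN ler_norm.
pose s c := Num.sqrt (4 * t * (L - c)).
have sE c : 0 <= L - c -> s c ^+ 2 = 4 * t * (L - c).
  by move=> Lc; rewrite sqr_sqrtr// mulr_ge0// ltW.
have s0 c : 0 <= s c by exact: sqrtr_ge0.
(* [S] bounds both points, and the hypothesis on [64 K^2] amounts to [K S / t <= eps / 4]; on
   [[0, S]] the error is then at most [eps / 2]. *)
pose S := Num.sqrt (4 * t * (L + `|a| + `|b|)).
have SE : S ^+ 2 = 4 * t * (L + `|a| + `|b|).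
  rewrite sqr_sqrtr// mulr_ge0 ?(ltW t4)//.
  by have := normr_ge0 a; have := normr_ge0 b; lra.
have S0 : 0 <= S by exact: sqrtr_ge0.
have saS : s a <= S.
  apply: ler_wsqrtr; rewrite ler_pM2l//; have := normr_ge0 b; lra.
have sbS : s b <= S.
  apply: ler_wsqrtr; rewrite ler_pM2l//; have := normr_ge0 a; lra.
have KS : K * S / t <= eps / 4.
  rewrite ler_pdivrMr// -(@ler_pXn2r _ 2)// ?nnegrE ?mulr_ge0 ?(ltW t0)//; last lra.
  rewrite !exprMn SE; have := ler_wpM2r (ltW t0) LK; lra.
have err c : 0 <= c <= S -> `|g c - (L - c ^+ 2 / (4 * t))| <= eps / 2.
  move=> /andP[c0 cS]; apply: le_trans (gP c) _; rewrite (ger0_norm c0).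
  have : K * c / t <= K * S / t.
    by rewrite ler_pM2r ?invr_gt0// ler_wpM2l.
  lra.
exists (s a), (s b); split.
- have := err (s a); rewrite s0 saS sE; last lra.
  by rewrite mulrC mulKf ?gt_eqF// => /(_ isT); rewrite ler_norml => /andP[]; lra.
- have := err (s b); rewrite s0 sbS sE//.
  by rewrite mulrC mulKf ?gt_eqF// => /(_ isT); rewrite ler_norml => /andP[]; lra.
have := s0 a; have := s0 b; have := sE a; have := sE b Lb'.
move: (s a) (s b) saS sbS => u v uS vS vE /(_ _) uE v0 u0.
have {}uE : u ^+ 2 = 4 * t * (L - a) by apply: uE; lra.
have := err ((1 - p) * u + p * v).
have -> : 0 <= (1 - p) * u + p * v <= S.
  by rewrite addr_ge0 ?mulr_ge0 ?subr_ge0 ?(ltW p0) ?(ltW p1)//=; nra.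
move=> /(_ isT); rewrite ler_norml => /andP[_].
(* The parabola lies above its chord by [p (1 - p) (u - v)^2 / (4 t)]. *)
have -> : ((1 - p) * u + p * v) ^+ 2 =
    (1 - p) * u ^+ 2 + p * v ^+ 2 - p * (1 - p) * (u - v) ^+ 2 by ring.
rewrite uE vE.
have -> : ((1 - p) * (4 * t * (L - a)) + p * (4 * t * (L - b)) -
    p * (1 - p) * (u - v) ^+ 2) / (4 * t) =
    (1 - p) * (L - a) + p * (L - b) - p * (1 - p) * ((u - v) ^+ 2 / (4 * t)).
  by field; rewrite gt_eqF.
(* As [(u - v) (u + v) = 4 t (b - a)], [u + v >= u] and [u^2 = 4 t (L - a)], the left side is at
   most [(b - a)^2 / (L - a)]. *)
have uv : (u - v) ^+ 2 / (4 * t) <= eps / 2.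
  rewrite ler_pdivrMr//.
  have h1 : (u - v) ^+ 2 * u ^+ 2 <= (4 * t * (b - a)) ^+ 2.
    have -> : 4 * t * (b - a) = (u - v) * (u + v).
      have -> : (u - v) * (u + v) = u ^+ 2 - v ^+ 2 by ring.
      by rewrite uE vE; ring.
    rewrite exprMn ler_wpM2l ?sqr_ge0//.
    by rewrite ler_pXn2r ?nnegrE ?addr_ge0// lerDl.
  have u2 : 0 < u ^+ 2 by rewrite uE mulr_gt0//; lra.
  rewrite -(ler_pM2r u2); apply: (le_trans h1).
  rewrite uE exprMn.
  have := ler_wpM2l (sqr_ge0 (4 * t)) Lab.
  by lra.
have pp : 0 <= p * (1 - p) <= 1 by apply/andP; split; nra.
have : p * (1 - p) * ((u - v) ^+ 2 / (4 * t)) <= eps / 2.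
  apply: le_trans uv; rewrite ler_piMl ?divr_ge0 ?sqr_ge0 ?(ltW t4)//.
  by case/andP: pp.
by lra.
Qed.

(** On the first coordinate axis [ln U] is a one-variable profile close to a parabola with vertex
    [L = k ln (4 pi t) + ln M], so that [almost_affine_levels] applies for a suitable [t]. *)
Lemma U_almost_affine_levels {R : realType} {n : nat} (phi : 'rV[R]_n.+1 -> R)
    (d T a b p eps : R) :
  heat_datum phi -> n.+1%:R / 2 < d -> 0 < p < 1 -> 0 < eps ->
  exists t x y, [/\ T <= t, 0 < t,
    a - eps <= ln (U d phi x t), b - eps <= ln (U d phi y t) &
    ln (U d phi ((1 - p) *: x + p *: y) t) <= (1 - p) * a + p * b + eps].
Proof.
move=> phiL hd p01 eps0.
have [r r0 supp] := heat_datum_bounded_support _ phiL.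
set M := \int[lebesgue_rV R n]_(y in setT) phi y.
pose k := d - n.+1%:R / 2; have k0 : 0 < k by rewrite subr_gt0.
pose m : R := n.+1%:R; pose K := m * r / 2.
have m0 : 0 < m by rewrite ltr0Sn.
have K0 : 0 < K by rewrite /K divr_gt0 ?mulr_gt0.
(* [L0] collects the lower bounds required of [L], and gives [L + |a| + |b| <= 2 L]; the factor
   [128 = 64 * 2] in the slope below comes from this. The condition [m r^2 / eps <= t] brings the
   constant part of [tilt_error] under [eps / 4]. *)
pose L0 := 1 + `|a| + `|b| + 2 * (b - a) ^+ 2 / eps.
have eta0 : 0 < eps ^+ 2 / (128 * K ^+ 2 + 1).
  by rewrite divr_gt0 ?exprn_gt0// ltr_wpDl// mulr_ge0// sqr_ge0.
have [t [Tt t0 L0L Lt]] := affine_ln_sublinear _ (ln M) L0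
  (Num.max T (m * r ^+ 2 / eps)) _ k0 eta0.
move: Tt; rewrite ge_max => /andP[Tt rt].
set L := k * ln (4 * pi * t) + ln M in L0L Lt.
pose e : 'rV[R]_n.+1 := delta_mx 0 0.
pose g s := ln (U d phi (s *: e) t).
have gP s : `|g s - (L - s ^+ 2 / (4 * t))| <= K * `|s| / t + eps / 4.
  rewrite /g (ln_U _ phiL d t (s *: e) t0) sqnorm_delta -/k.
  have := ln_tilted_bounds phi r t (s *: e) phiL t0 supp.
  rewrite -/M /tilt_error sqnorm_delta sqrtr_sqr -/m /L.
  move: (ln (tilted phi t (s *: e))) (ln M) (ln (4 * pi * t)) => A B C.
  rewrite (_ : k * C - s ^+ 2 / (4 * t) + A - (k * C + B - s ^+ 2 / (4 * t)) =
    A - B); last by ring.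
  move=> /le_trans; apply; apply: lerD.
    by rewrite /K le_eqVlt; apply/orP; left; apply/eqP; field; rewrite gt_eqF.
  rewrite ler_pdivrMr ?mulr_gt0//; move: rt; rewrite ler_pdivrMr//.
  by lra.
have ab0 : 0 <= 2 * (b - a) ^+ 2 / eps by rewrite divr_ge0 ?(ltW eps0)// mulr_ge0 ?sqr_ge0.
have a0 := normr_ge0 a; have b0 := normr_ge0 b.
have [||||sa [sb [ha hb hc]]] :=
    almost_affine_levels t L eps K a b p g t0 eps0 (ltW K0) p01 gP.
- by move: L0L; rewrite /L0; lra.
- by move: L0L; rewrite /L0; lra.
- have : 2 * (b - a) ^+ 2 / eps <= L - a.
    by have := ler_norm a; move: L0L; rewrite /L0; lra.
  by rewrite ler_pdivrMr// [_ * eps]mulrC.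
- have LL : L + `|a| + `|b| <= 2 * L by move: L0L; rewrite /L0; lra.
  have Lp : 0 <= L by move: L0L; rewrite /L0; lra.
  have KK : 0 <= 64 * K ^+ 2 by rewrite mulr_ge0// sqr_ge0.
  have := ler_wpM2l KK LL; move: Lt; rewrite mulrAC ler_pdivlMr; last by lra.
  by lra.
exists t, (sa *: e), (sb *: e).
have -> : (1 - p) *: (sa *: e) + p *: (sb *: e) = ((1 - p) * sa + p * sb) *: e.
  by rewrite !scalerA -scalerDl.
by split; [exact: Tt|exact: t0|exact: ha|exact: hb|exact: hc].
Qed.

(** * Passage to the limit in the levels *)

Section admissible.
Context {R : realType} {F : R -> \bar R}.
Hypothesis Fadm : admissible F.

Lemma admissible_expR_EFin (s : R) : (fine (F (expR s)))%:E = F (expR s).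
Proof.
have [Flty _ Fincr F0] := Fadm; rewrite fineK// fin_numElt Flty ?expR_ge0// andbT.
by rewrite -F0 Fincr// expR_gt0.
Qed.

Lemma continuous_admissible_expR : continuous (fun s : R => fine (F (expR s))).
Proof.
have [_ Fcont _ _] := Fadm; move=> s; apply: fine_cvg.
rewrite admissible_expR_EFin.
apply: (@continuous_comp _ _ _ expR F); first exact: continuous_expR.
exact: Fcont (expR_gt0 s).
Qed.

Lemma admissible_le (u v : R) : 0 <= u -> u <= v -> (F u <= F v)%E.
Proof.
have [_ _ Fincr _] := Fadm => u0; rewrite le_eqVlt => /predU1P[->//|uv].
exact/ltW/Fincr.
Qed.

End admissible.

(** At a time given by [U_almost_affine_levels], monotonicity of [F] turns F-concavity into the
    inequality at the levels [a - eps], [b - eps] and [(1 - p) a + p b + eps]; continuity of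
    [F (e^s)] then removes [eps]. *)
Lemma eventually_Fconcave_expR {R : realType} {n : nat} (F : R -> \bar R) (d : R)
    (phi : 'rV[R]_n.+1 -> R) (a b p : R) :
  admissible F -> n.+1%:R / 2 < d -> heat_datum phi ->
  eventually_Fconcave F (U d phi) -> 0 < p < 1 ->
  ((1 - p)%:E * F (expR a) + p%:E * F (expR b) <=
    F (expR ((1 - p) * a + p * b)))%E.
Proof.
move=> Fadm hd phiL [T [T0 FT]] p01; have /andP[p0 p1] := p01.
pose f s := fine (F (expR s)); set c := (1 - p) * a + p * b.
have fE s : F (expR s) = (f s)%:E by rewrite admissible_expR_EFin.
have fcont : continuous f by exact: continuous_admissible_expR.
have ineq eps : 0 < eps -> (1 - p) * f (a - eps) + p * f (b - eps) <= f (c + eps).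
  move=> eps0.
  have [t [x [y [Tt t0 ha hb hc]]]] :=
    U_almost_affine_levels phi d T a b p eps phiL hd p01 eps0.
  have conc : ((1 - p)%:E * F (U d phi x t) + p%:E * F (U d phi y t) <=
      F (U d phi ((1 - p) *: x + p *: y)%R t))%E := (FT t Tt).2 x y p p01.
  rewrite -lee_fin EFinD !EFinM -!fE.
  have := U_gt0 _ phiL d t x t0; have := U_gt0 _ phiL d t y t0.
  have := U_gt0 _ phiL d t ((1 - p) *: x + p *: y) t0.
  move: conc ha hb hc; rewrite -/c.
  move: (U d phi (_ + _) t) (U d phi x t) (U d phi y t) => w u v conc ha hb hc w0 v0 u0.
  apply: (@le_trans _ _ (F w)).
    apply: le_trans conc; apply: leeD; apply: lee_wpmul2l.
    - by rewrite lee_fin subr_ge0 ltW.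
    - by apply: admissible_le => //; rewrite ?expR_ge0// -[leRHS]lnK ?posrE// ler_expR.
    - by rewrite lee_fin ltW.
    - by apply: admissible_le => //; rewrite ?expR_ge0// -[leRHS]lnK ?posrE// ler_expR.
  by apply: admissible_le => //; [exact: ltW | rewrite -[leLHS]lnK ?posrE// ler_expR].
rewrite !fE -!EFinM -EFinD lee_fin -subr_ge0.
pose g eps := f (c + eps) - ((1 - p) * f (a - eps) + p * f (b - eps)).
rewrite [leRHS](_ : _ = g 0); last by rewrite /g addr0 !subr0.
have gcont : {for 0, continuous g}.
  have fD (q : R) : {for 0, continuous (fun eps => f (q + eps))}.
    apply: (@continuous_comp _ _ _ (fun eps => q + eps) f); last exact: fcont.
    by apply: cvgD; [exact: cvg_cst | exact: cvg_id].
  have fB (q : R) : {for 0, continuous (fun eps => f (q - eps))}.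
    apply: (@continuous_comp _ _ _ (fun eps => q - eps) f); last exact: fcont.
    by apply: cvgB; [exact: cvg_cst | exact: cvg_id].
  apply: cvgB; first exact: fD.
  by apply: cvgD; apply: cvgMr; exact: fB.
(* [ineq] is available for positive [eps], hence a limit from the right. *)
have gcvg := cvg_at_right_filter gcont.
rewrite -(cvg_lim _ gcvg)//; apply: limr_ge; first by apply/cvg_ex; exists (g 0).
near=> eps; rewrite /g subr_ge0; apply: ineq.
by near: eps; exact: nbhs_right_gt.
Unshelve. all: by end_near. Qed.

Theorem theorem1p5 (R : realType) (n : nat) (F : R -> \bar R) (d : R)
    (phi : 'rV[R]_n.+1 -> R) :
  admissible F -> n.+1%:R / 2 < d -> heat_datum phi ->
  (eventually_Fconcave F (U d phi) <-> weaker_concavity n F log).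
Proof.
move=> Fadm hd phiL; split=> [Fconc|logF].
  apply: weaker_concavity_log => // a b p p01.
  exact: eventually_Fconcave_expR Fconc p01.
have [T [T0 logU]] := Fconcave_log_U phi d phiL.
by exists T; split=> // t Tt; exact/logF/logU.
Qed.
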